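(* Let $N\ge 1$, $\mu_1,\dots,\mu_N>0$, $\alpha>0$, $\beta>0$, $\gamma\in\mathbb{R}$, $c\ge 0$, $\lambda>0$. Let $D:=\operatorname{diag}(\mu_1^\beta,\dots,\mu_N^\beta)$, $\mu:=(\mu_1,\dots,\mu_N)$, and $$H(q):=\sum_{i=1}^N\mu_i^{1-\beta}q_i+\frac{\lambda}{\alpha}\log\!\left(\sum_{j=1}^N\mu_j^\gamma\exp\!\left(-\alpha(q_j+c)/\mu_j^\beta\right)\right).$$ Then for every $q\in\mathbb{R}_+^N$, $$\partial_iH(q)=\frac{\mu_i-\lambda p_i(q)}{\mu_i^\beta},\qquad i=1,\dots,N.$$ Equivalently, $\lambda p(q)-\mu=-D\nabla H(q)$.
   Context: Here $\mathbb{R}_+^N=[0,\infty)^N$, and $p(q)=(p_1(q),\dots,p_N(q))$ with $p_i(q)=w_i(q)/\sum_{j=1}^Nw_j(q)$, $w_i(q)=\mu_i^\gamma\exp(-\alpha(q_i+c)/\mu_i^\beta)$. The formula for $H$ is smooth on all of $\mathbb{R}^N$, so its partial derivatives make sense at boundary points of the orthant. *)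

(* Defs.v *)
From HB Require Import structures.
From mathcomp Require Import all_boot all_order all_algebra.
From mathcomp Require Import all_classical all_reals all_analysis.

Set Implicit Arguments.
Unset Strict Implicit.
Unset Printing Implicit Defensive.

Import Order.TTheory GRing.Theory Num.Theory.
Import numFieldNormedType.Exports.

Local Open Scope ring_scope.

Section Defs.
Context {R : realType} {N : nat}.

Definition orthant : set 'cV[R]_N := [set q | forall i, 0 <= q i 0]%classic.

Definition weight (mu : 'cV[R]_N) (alpha beta gamma c : R) (q : 'cV[R]_N)
    (i : 'I_N) : R :=
  mu i 0 `^ gamma * expR (- (alpha * (q i 0 + c)) / mu i 0 `^ beta).

Definition routing (mu : 'cV[R]_N) (alpha beta gamma c : R) (q : 'cV[R]_N) :
    'cV[R]_N :=
  \col_i (weight mu alpha beta gamma c q i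
          / \sum_j weight mu alpha beta gamma c q j).

Definition potential (mu : 'cV[R]_N) (alpha beta gamma c lambda : R)
    (q : 'cV[R]_N) : R :=
  \sum_i mu i 0 `^ (1 - beta) * q i 0
  + lambda / alpha
    * ln (\sum_j mu j 0 `^ gamma
                 * expR (- (alpha * (q j 0 + c)) / mu j 0 `^ beta)).

Definition scaling_mx (mu : 'cV[R]_N) (beta : R) : 'M[R]_N :=
  diag_mx (\row_i mu i 0 `^ beta).

(* ['D_v f q] is a total operator with a junk value where the derivative does
   not exist, so [gradient f q] is meaningful only together with
   [derivable f q (delta_mx i 0)] for every [i]. *)
Definition gradient (f : 'cV[R]_N -> R) (q : 'cV[R]_N) : 'cV[R]_N :=
  \col_i 'D_(delta_mx i 0) f q.

End Defs.

(* Main.v *)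
Require Import Defs.
From HB Require Import structures.
From mathcomp Require Import all_boot all_order all_algebra.
From mathcomp Require Import all_classical all_reals all_analysis.
From mathcomp Require Import ring.

Import Order.TTheory GRing.Theory Num.Theory.
Import numFieldNormedType.Exports.

Local Open Scope ring_scope.

(** Each weight $w_j$ is the exponential of an affine function of $q_j$ times a constant, so its
    derivative along $v$ is $-\alpha\mu_j^{-\beta}v_jw_j$. Differentiating $\log\sum_jw_j$ divides
    the sum of these by $\sum_jw_j$, which turns the weights into the probabilities $p_j$, and the
    factor $\lambda/\alpha$ cancels $\alpha$. With $\mu_j^{1-\beta}=\mu_j/\mu_j^\beta$ from the
    linear part, the derivative of $H$ along $v$ is $\sum_j(\mu_j-\lambda p_j)\mu_j^{-\beta}v_j$
    ([is_derive_potential]); taking $v=e_i$ gives the partial derivatives. *)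

Section DirectionalDerivative.
Context {R : realType} {V : normedModType R}.

(* [is_derive1_comp] only covers functions R -> R; restricting to a line
   transfers it to directional derivatives. *)
Lemma is_derive_line (W : normedModType R) (f : V -> W) (a v : V) (df : W) :
  is_derive (0 : R) 1 (fun h : R => f (h *: v + a)) df <-> is_derive a v f df.
Proof.
(* Both difference quotients are the same function of [h], so existence and value of the limit
   transfer together. *)
have quotientE :
    (fun h : R => h^-1 *: (((fun h : R => f (h *: v + a)) \o shift 0) (h *: 1)
                           - f (0 *: v + a)))
    = (fun h : R => h^-1 *: ((f \o shift a) (h *: v) - f a)).
  by apply/funext => h /=; rewrite addr0 scale0r add0r /GRing.scale /= mulr1.
by split=> -[cv dv]; split; move: cv dv; rewrite /derivable /derive quotientE.
Qed.

Lemma is_derive_comp (g : R -> R) (f : V -> R) (a v : V) (dg df : R) :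
  is_derive (f a) 1 g dg -> is_derive a v f df ->
  is_derive a v (fun x => g (f x)) (dg * df).
Proof.
move=> g'; rewrite -is_derive_line => f'; apply/is_derive_line.
by apply: (is_derive1_comp (f := g)); rewrite ?scale0r ?add0r.
Qed.

End DirectionalDerivative.

Lemma is_derive_coord (R : realType) (m n : nat) (i : 'I_m) (j : 'I_n)
    (A B : 'M[R]_(m, n)) :
  is_derive A B (fun M : 'M[R]_(m, n) => M i j) (B i j).
Proof.
apply/is_derive_line.
have -> : (fun h : R => (h *: B + A) i j) = B i j \*: id + cst (A i j).
  by apply/funext => h; rewrite !mxE /= mulrC.
by apply: is_derive_eq; rewrite addr0 /GRing.scale /= mulr1.
Qed.

Section Potential.
Context {R : realType} {N : nat}.
Variables (mu : 'cV[R]_N) (alpha beta gamma c : R).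

Lemma is_derive_weight (q v : 'cV[R]_N) (j : 'I_N) :
  is_derive q v (fun x => weight mu alpha beta gamma c x j)
    (weight mu alpha beta gamma c q j * (- alpha / mu j 0 `^ beta * v j 0)).
Proof.
have dexponent : is_derive q v
    (fun x : 'cV[R]_N => - (alpha * (x j 0 + c)) / mu j 0 `^ beta)
    (- alpha / mu j 0 `^ beta * v j 0).
  (* Splitting the exponent into a multiple of a coordinate plus a constant lets instance inference
     find its derivative. *)
  have -> : (fun x : 'cV[R]_N => - (alpha * (x j 0 + c)) / mu j 0 `^ beta)
      = (- alpha / mu j 0 `^ beta) \*: (fun x : 'cV[R]_N => x j 0)
        + cst (- alpha / mu j 0 `^ beta * c).
    apply/funext => x.
    have -> // : - (alpha * (x j 0 + c)) / mu j 0 `^ beta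
      = - alpha / mu j 0 `^ beta * x j 0 + - alpha / mu j 0 `^ beta * c.
    by ring.
  have dcoord := is_derive_coord R N 1 j 0 q v.
  by apply: is_derive_eq; rewrite addr0.
have dexp := is_derive_comp _ _ _ _ _ _ (is_derive_expR _) dexponent.
by apply: (is_derive_eq (is_deriveZ (mu j 0 `^ gamma) dexp)); exact: mulrA.
Qed.

Hypothesis mu_gt0 : forall i, 0 < mu i 0.

Lemma weight_gt0 (q : 'cV[R]_N) (i : 'I_N) :
  0 < weight mu alpha beta gamma c q i.
Proof. by rewrite mulr_gt0 ?expR_gt0 ?powR_gt0. Qed.

(** An index exists, so at least one term is strictly positive. This places the argument of [ln]
    where it is differentiable. *)
Lemma sum_weight_gt0 (q : 'cV[R]_N) :
  (0 < N)%N -> 0 < \sum_j weight mu alpha beta gamma c q j.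
Proof.
move=> N_gt0; rewrite (bigD1 (Ordinal N_gt0)) //= ltr_pwDl ?weight_gt0 //.
by apply: sumr_ge0 => j _; exact/ltW/weight_gt0.
Qed.

Lemma is_derive_potential (lambda : R) (q v : 'cV[R]_N) :
  (0 < N)%N -> alpha != 0 ->
  is_derive q v (potential mu alpha beta gamma c lambda)
    (\sum_j (mu j 0 - lambda * routing mu alpha beta gamma c q j 0)
            / mu j 0 `^ beta * v j 0).
Proof.
move=> N_gt0 alpha_neq0; set W := weight mu alpha beta gamma c.
(* As a combination of functions rather than of values, the potential matches the sum and scaling
   rules. *)
have -> : potential mu alpha beta gamma c lambda
    = \sum_j (mu j 0 `^ (1 - beta)) \*: (fun x : 'cV[R]_N => x j 0)
      + (lambda / alpha) \*: (fun x => ln ((\sum_j W ^~ j) x)).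
  apply/funext => x; rewrite /potential /W /weight.
  by rewrite [RHS]/GRing.add /= !fct_sumE.
have dlin := is_derive_sum (fun j : 'I_N => is_deriveZ (mu j 0 `^ (1 - beta))
  (is_derive_coord R N 1 j 0 q v)).
have dsum := is_derive_sum (is_derive_weight q v).
have sum_gt0 := sum_weight_gt0 q N_gt0.
have dln : is_derive ((\sum_j W ^~ j) q) 1 (@ln R) ((\sum_j W ^~ j) q)^-1.
  by apply: is_derive1_ln; rewrite fct_sumE.
have dlnsum := is_derive_comp _ _ _ _ _ _ dln dsum.
apply: is_derive_eq; rewrite fct_sumE /GRing.scale /= !mulr_sumr -big_split /=.
apply: eq_bigr => j _; rewrite mxE -/(W q j).
have muj_neq0 : mu j 0 != 0 by rewrite gt_eqF.
(* Writing $\mu_j^{1-\beta}$ as $\mu_j/\mu_j^\beta$ leaves a rational identity with denominators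
   [alpha], $\mu_j^\beta$ and the total weight. *)
rewrite powRB ?muj_neq0 ?implybT // powRr1 ?ltW //.
have : mu j 0 `^ beta != 0 by rewrite gt_eqF ?powR_gt0.
have : \sum_k W q k != 0 by rewrite gt_eqF.
by move=> ? ?; field; apply/and3P.
Qed.

End Potential.

Theorem proposition3p4 (R : realType) (N : nat) (mu : 'cV[R]_N)
    (alpha beta gamma c lambda : R)
    (hN : (1 <= N)%N) (hmu : forall i : 'I_N, 0 < mu i 0)
    (halpha : 0 < alpha) (hbeta : 0 < beta) (hc : 0 <= c)
    (hlambda : 0 < lambda) :
  let H := potential mu alpha beta gamma c lambda in
  let p := routing mu alpha beta gamma c in
  let D := scaling_mx mu beta in
  forall q : 'cV[R]_N, orthant q ->
    (forall i : 'I_N,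
       is_derive q (delta_mx i 0) H
         ((mu i 0 - lambda * p q i 0) / mu i 0 `^ beta))
    /\ lambda *: p q - mu = - (D *m gradient H q).
Proof.
move=> H p D q _.
have dH i : is_derive q (delta_mx i 0) H
    ((mu i 0 - lambda * p q i 0) / mu i 0 `^ beta).
  have dHv := is_derive_potential _ _ beta gamma c hmu lambda q (delta_mx i 0)
    hN (lt0r_neq0 halpha).
  apply: is_derive_eq.
  (* Along $e_i$ only the term $j=i$ survives. *)
  rewrite (bigD1 i) //= big1 => [|j /negPf ji]; rewrite [delta_mx _ _ _ _]mxE.
    by rewrite !eqxx mulr1 addr0.
  by rewrite ji mulr0.
split=> //; apply/colP => i.
(* [derive_val] reads the gradient entry off [dH]; the diagonal entry $\mu_i^\beta$ then cancels its
   denominator. *)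
rewrite /D /scaling_mx mul_diag_mx !mxE derive_val !mxE.
by rewrite [_ `^ _ * _]mulrC divfK ?opprB // gt_eqF ?powR_gt0.
Qed.
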